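(* Let $p_0,p_0'\in(0,1)$. Let $(\xi_n)_{n\ge1}$ be independent identically distributed random variables with $P\{\xi_n=0\}=p_0$, $P\{\xi_n=1\}=1-p_0$, and let $(\xi_n')_{n\ge1}$ be independent identically distributed random variables with $P\{\xi'_n=0\}=p_0'$, $P\{\xi'_n=1\}=1-p_0'$. Put $\hat\xi=\Delta^{G_2}_{\xi_1\xi_2\ldots\xi_n\ldots}$ and $\hat\xi'=\Delta^{G_2}_{\xi'_1\xi'_2\ldots\xi'_n\ldots}$. If the distributions of $\hat\xi$ and $\hat\xi'$ are different, then they are mutually orthogonal (mutually singular), i.e., there is a Borel set $B\subset[0,g_0]$ with $P\{\hat\xi\in B\}=1$ and $P\{\hat\xi'\in B\}=0$.
   Context: Fix a real number $g_0\in[\frac12,1)$ and put $g_1=g_0-1$, $\delta_0=0$, $\delta_1=g_0$. For a sequence $(\alpha_n)_{n\ge1}$ of elements of $\{0,1\}$ put $$\Delta^{G_2}_{\alpha_1\alpha_2\ldots\alpha_n\ldots}=\delta_{\alpha_1}+\sum_{k=2}^\infty \delta_{\alpha_k}\prod_{j=1}^{k-1}g_{\alpha_j}\in[0,g_0].$$ Every $x\in[0,g_0]$ equals $\Delta^{G_2}_{\alpha_1\alpha_2\ldots}$ for some sequence of zeros and ones (a $G_2$-representation of $x$). The representation is unique except for countably many numbers having exactly two representations. The random variables $\hat\xi,\hat\xi'$ are taken to be continuous (without atoms), which is what $p_0,p_0'\in(0,1)$ expresses. *)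

(* Defs.v *)
From HB Require Import structures.
From mathcomp Require Import all_boot all_order all_algebra.
From mathcomp Require Import all_classical all_reals all_analysis.
From mathcomp Require Import measurable_realfun lra.

Set Implicit Arguments.
Unset Strict Implicit.
Unset Printing Implicit Defensive.

Import Order.TTheory GRing.Theory Num.Theory.
Import numFieldNormedType.Exports.

Local Open Scope classical_set_scope.
Local Open Scope ring_scope.

Section G2_representation.
Context {R : realType} (g0 : R).

(* Digits are booleans, with false for 0 and true for 1. *)
Definition gG2 (b : bool) : R := if b then g0 - 1 else g0.
Definition deltaG2 (b : bool) : R := if b then g0 else 0.

(* Sequences are indexed from 0: [a k] is the digit alpha_(k+1), and the term
   of index 0, with its empty product, is delta_(alpha_1). *)
Definition DeltaG2 (a : nat -> bool) : R :=
  limn (fun n => \sum_(0 <= k < n) deltaG2 (a k) * \prod_(j < k) gG2 (a j)).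

Lemma is_cvg_DeltaG2 (a : nat -> bool) : g0 \in `[2^-1, 1[ ->
  cvgn (fun n => \sum_(0 <= k < n) deltaG2 (a k) * \prod_(j < k) gG2 (a j)).
Proof.
rewrite in_itv /= => /andP[hg hg1].
have g0_ge0 : 0 <= g0 by lra.
have normg b : `|gG2 b| <= g0 by rewrite ler_norml /gG2; case: b; lra.
apply: normed_cvg.
apply: (@series_le_cvg _ _ (geometric g0 g0)) => [k|k|k|].
- exact: normr_ge0.
- by rewrite /geometric/= mulr_ge0// exprn_ge0.
- rewrite /= normrM ler_pM//; first by case: (a k); rewrite /deltaG2 ?normr0// ger0_norm.
  rewrite normr_prod (le_trans (ler_prod _ (E2 := fun=> g0) _))//.
    by move=> i _; rewrite normr_ge0 normg.
  by rewrite prodr_const card_ord.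
- by apply: is_cvg_geometric_series; rewrite ger0_norm.
Qed.

End G2_representation.

Section random_variables.
Context {R : realType}.

Definition eq_distribution d1 d2 d' (T1 : measurableType d1)
    (T2 : measurableType d2) (T' : measurableType d')
    (P1 : probability T1 R) (P2 : probability T2 R)
    (X1 : {RV P1 >-> T'}) (X2 : {RV P2 >-> T'}) : Prop :=
  forall A : set T', measurable A -> distribution P1 X1 A = distribution P2 X2 A.

Definition identically_distributed d d' (T : measurableType d)
    (T' : measurableType d') (P : probability T R)
    (X : nat -> {RV P >-> T'}) : Prop :=
  forall m n, eq_distribution (X m) (X n).

Definition mutually_independent d d' (T : measurableType d)
    (T' : measurableType d') (P : probability T R)
    (X : nat -> {RV P >-> T'}) : Prop :=
  forall (s : seq nat) (A : nat -> set T'), uniq s ->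
    (forall i, measurable (A i)) ->
    P (\bigcap_(i in [set` s]) X i @^-1` A i)
    = (\prod_(i <- s) P (X i @^-1` A i))%E.

End random_variables.

Section random_G2.
Context {R : realType} {g0 : R} d (T : measurableType d).

Let measurable_DeltaG2 (a : nat -> T -> bool) : g0 \in `[2^-1, 1[ ->
  (forall n, measurable_fun setT (a n)) ->
  measurable_fun setT (fun w => DeltaG2 g0 (a ^~ w)).
Proof.
move=> hg0 ma.
apply: (@measurable_fun_cvg _ _ _ _ (fun n w =>
  \sum_(0 <= k < n) deltaG2 g0 (a k w) * \prod_(j < k) gG2 g0 (a j w))); last first.
  by move=> w _; apply: is_cvg_DeltaG2.
move=> n; apply: measurable_sum => k; apply: measurable_funM.
  exact: measurable_fun_ifT.
by apply: measurable_prod => j _; exact: measurable_fun_ifT.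
Qed.

Context (P : probability T R).

(* The hypothesis on g0 is an argument because it makes the series converge,
   hence the sum measurable. *)
Definition randomG2 (hg0 : g0 \in `[2^-1, 1[) (xi : nat -> {RV P >-> bool}) :
  T -> R := fun w => DeltaG2 g0 (xi ^~ w).

HB.instance Definition _ hg0 xi := isMeasurableFun.Build _ _ T R (randomG2 hg0 xi)
  (measurable_DeltaG2 hg0 (fun n => measurable_funPT (xi n))).

End random_G2.

(* Main.v *)
Require Import Defs.
From mathcomp Require Import all_boot all_order all_algebra.
From mathcomp Require Import all_classical all_reals all_analysis.
From mathcomp Require Import measurable_realfun ring lra.
Import Order.TTheory GRing.Theory Num.Theory.
Import numFieldNormedType.Exports.
Local Open Scope classical_set_scope.
Local Open Scope ring_scope.

(** The digits form two coin-tossing sequences, with parameters [p0] and [p0']; let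
[q] and [q'] be the weights that they give to a digit, and to a word by
multiplication.

If [p0 = p0'], the two digit sequences have the same law on the space of binary
sequences, because they agree on cylinders and cylinders form a pi-system
([law_of_iid_unique]). The number is a measurable function of its digits, so
[randomG2] has the same law in both cases ([law_randomG2_unique]). Hence the
hypothesis that the distributions differ gives [p0 <> p0'].

If [p0 <> p0'], the two digit sequences are separated by the likelihood-ratio
test. Let [A n] be the set of sequences whose first [n] digits are at most as
likely under the weights [q] as under [q']. Since [x <= y] implies
[x <= sqrt (x * y)], the [q]-probability of [A n] is at most the sum of
[sqrt (q(s) q'(s))] over all binary words [s] of length [n], which is the
[n]-th power of the affinity [sqrt (p0 p0') + sqrt ((1 - p0) (1 - p0'))]
([less_likely_prob]). The affinity is less than 1
([affinity_bernoulli_lt1]), so by the Borel-Cantelli lemma [q]-almost every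
sequence lies in only finitely many [A n]. Exchanging the roles of [q] and
[q'], [q']-almost every sequence lies in [A n] for all large [n].

It remains to transport this event to the real line. Almost every sequence has
infinitely many digits 1 ([infinitely_often_true]), and such a sequence is
recovered from the number it represents by measurable digit functions
([G2digit_Delta]). The separating Borel set is [likelihood_set]: the numbers of
[[0, g0]] whose recovered digits lie in only finitely many [A n]. *)

(** * Recovering the digits of a number *)

Section digit_recovery.
Context {R : realType} {g0 : R}.
Hypothesis hg0 : g0 \in `[2^-1, 1[.
Implicit Types (a : nat -> bool) (x : R).

Lemma partial_DeltaG2S a n :
  \sum_(0 <= k < n.+1) deltaG2 g0 (a k) * \prod_(j < k) gG2 g0 (a j) =
  deltaG2 g0 (a 0%N) + gG2 g0 (a 0%N) *
    \sum_(0 <= k < n) deltaG2 g0 (a k.+1) * \prod_(j < k) gG2 g0 (a j.+1).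
Proof.
rewrite big_nat_recl//= big_ord0 mulr1; congr (_ + _).
rewrite big_distrr/=; apply: eq_bigr => k _; rewrite big_ord_recl/= mulrCA.
by congr (_ * (_ * _)).
Qed.

Lemma DeltaG2_cons a :
  DeltaG2 g0 a = deltaG2 g0 (a 0%N) + gG2 g0 (a 0%N) * DeltaG2 g0 (a \o succn).
Proof.
apply/cvg_lim => //.
rewrite -(cvg_shiftS (fun n =>
  \sum_(0 <= k < n) deltaG2 g0 (a k) * \prod_(j < k) gG2 g0 (a j))) /=.
under eq_cvg do rewrite partial_DeltaG2S.
apply: cvgD; first exact: cvg_cst.
by apply: cvgMr; exact: (@is_cvg_DeltaG2 R g0 (a \o succn) hg0).
Qed.

Lemma DeltaG2_itv a : 0 <= DeltaG2 g0 a <= g0.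
Proof.
move: (hg0); rewrite in_itv/= => /andP[g0_ge g0_lt].
suff H n b : 0 <= \sum_(0 <= k < n) deltaG2 g0 (b k) * \prod_(j < k) gG2 g0 (b j)
                <= g0.
  have cv := @is_cvg_DeltaG2 _ g0 a hg0.
  apply/andP; split; [apply: limr_ge|apply: limr_le] => //; apply: nearW => n.
    by have /andP[] := H n a.
  by have /andP[] := H n a.
elim: n b => [|n IH] b; first by rewrite big_geq//; lra.
rewrite partial_DeltaG2S.
have /andP[] := IH (b \o succn); rewrite /=.
move: (\sum_(0 <= k < n) _) => s s0 s1.
by rewrite /deltaG2 /gG2; case: (b 0%N); apply/andP; split; nra.
Qed.

Lemma DeltaG2_eq0 a : DeltaG2 g0 a = 0 -> forall k, a k = false.
Proof.
move: (hg0); rewrite in_itv/= => /andP[g0_ge g0_lt].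
have H b : DeltaG2 g0 b = 0 -> b 0%N = false /\ DeltaG2 g0 (b \o succn) = 0.
  rewrite DeltaG2_cons; have /andP[] := DeltaG2_itv (b \o succn).
  rewrite /deltaG2 /gG2; case: (b 0%N) => s0 s1 e; first by nra.
  by split => //; nra.
move=> a0 k; elim: k a a0 => [a|k IH a] /H[]// _ /IH.
exact.
Qed.

(** The value [g0] is reached only by the digits 1000...; it is the value of
    the tail for which the first digit cannot be read off the number. *)
Lemma DeltaG2_eq_g0 a : DeltaG2 g0 a = g0 -> forall k, a k.+1 = false.
Proof.
move: (hg0); rewrite in_itv/= => /andP[g0_ge g0_lt].
rewrite DeltaG2_cons => e; apply: (@DeltaG2_eq0 (a \o succn)).
move: e; have /andP[] := DeltaG2_itv (a \o succn).
rewrite /deltaG2 /gG2; case: (a 0%N) => s0 s1 e; first by nra.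
by nra.
Qed.

(** The map that erases the first digit of a number. Numbers with first digit
    0 fill [[0, g0^2]] and those with first digit 1 fill [[g0^2, g0]]; at the
    common point [g0^2] the digit 0 is chosen. *)
Definition G2shift x : R := if g0 ^+ 2 < x then (g0 - x) / (1 - g0) else x / g0.

(** The digit of index [k] of [x], read by erasing the first [k] digits. *)
Definition G2digit k x : bool := g0 ^+ 2 < iter k G2shift x.

Lemma G2shift_Delta a : DeltaG2 g0 (a \o succn) != g0 ->
  (g0 ^+ 2 < DeltaG2 g0 a) = a 0%N /\
  G2shift (DeltaG2 g0 a) = DeltaG2 g0 (a \o succn).
Proof.
move: (hg0); rewrite in_itv/= => /andP[g0_ge g0_lt].
move=> ne; have /andP[s0 s1] := DeltaG2_itv (a \o succn).
have {ne}s1' : DeltaG2 g0 (a \o succn) < g0 by rewrite lt_neqAle ne.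
have E : (g0 ^+ 2 < DeltaG2 g0 a) = a 0%N.
  rewrite (DeltaG2_cons a) /deltaG2 /gG2; case: (a 0%N); first by nra.
  by apply/negbTE; rewrite -leNgt; nra.
split=> //; rewrite /G2shift E (DeltaG2_cons a) /deltaG2 /gG2.
by case: (a 0%N); field; apply/eqP; lra.
Qed.

(** A sequence of digits with infinitely many 1s is recovered from the number
    it represents. *)
Lemma G2digit_Delta a : (forall m, exists2 k, (m <= k)%N & a k) ->
  forall k, G2digit k (DeltaG2 g0 a) = a k.
Proof.
move=> inf1.
pose b k i := a (k + i)%N.
have bS k : b k \o succn = b k.+1 by apply/funext => i; rewrite /b /= addSnnS.
have ne k : DeltaG2 g0 (b k \o succn) != g0.
  rewrite bS; apply/eqP => /DeltaG2_eq_g0 H; have [l kl al] := inf1 k.+2.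
  by move: (H (l - k.+2)%N); rewrite /b -addSnnS subnKC// al.
have it k : iter k G2shift (DeltaG2 g0 a) = DeltaG2 g0 (b k).
  by elim: k => [//|k IH]; rewrite iterS IH (G2shift_Delta _ (ne k)).2 bS.
by move=> k; rewrite /G2digit it (G2shift_Delta _ (ne k)).1 /b addn0.
Qed.

Lemma measurable_G2digit k : measurable_fun setT (G2digit k).
Proof.
apply: measurable_fun_ltr => //.
elim: k => [|k IH]; first exact: measurable_id.
apply: (measurableT_comp (f := G2shift)) IH.
apply: measurable_fun_ifT => //.
- exact: measurable_fun_ltr.
- by apply: measurable_funM => //; exact: measurable_funB.
- exact: measurable_funM.
Qed.

End digit_recovery.

(** * The likelihood-ratio test for binary sequences *)

Lemma sqrt_prod (R : rcfType) (I : Type) (r : seq I) (B : pred I) (F : I -> R) :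
  (forall i, 0 <= F i) ->
  Num.sqrt (\prod_(i <- r | B i) F i) = \prod_(i <- r | B i) Num.sqrt (F i).
Proof.
move=> F0; elim/big_rec2: _ => [|i x y _ <-]; first exact: sqrtr1.
by rewrite sqrtrM.
Qed.

Section likelihood.
Context {R : realType}.
Implicit Types q : bool -> R.

(** The Bhattacharyya coefficient of two weights on [bool]. *)
Definition affinity q q' : R := \sum_b Num.sqrt (q b * q' b).

Lemma affinityC q q' : affinity q q' = affinity q' q.
Proof. by apply: eq_bigr => b _; rewrite mulrC. Qed.

(** The first [n] digits of [a] are at most as likely under [q] as under [q']. *)
Definition less_likely q q' n (a : nat -> bool) : bool :=
  \prod_(i < n) q (a i) <= \prod_(i < n) q' (a i).

(** The law of a digit: [p] is the weight of the digit 0, that is of [false]. *)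
Definition bernoulli_weight (p : R) (b : bool) : R := if b then 1 - p else p.

(** Twice the affinity is 2 minus the squared distance of the vectors of square
    roots of the weights. *)
Lemma affinity_bernoulli_lt1 p p' : p \in `]0, 1[ -> p' \in `]0, 1[ ->
  p != p' -> affinity (bernoulli_weight p) (bernoulli_weight p') < 1.
Proof.
rewrite !in_itv/= => /andP[p0 p1] /andP[p'0 p'1] pp'.
rewrite /affinity big_bool/= !sqrtrM ?subr_ge0 ?ltW//.
have sq (x : R) : 0 < x -> Num.sqrt x ^+ 2 = x by move=> x0; rewrite sqr_sqrtr// ltW.
have a := sq _ p0; have b := sq _ p'0.
have c : Num.sqrt (1 - p) ^+ 2 = 1 - p by apply: sq; lra.
have d : Num.sqrt (1 - p') ^+ 2 = 1 - p' by apply: sq; lra.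
have ne : Num.sqrt p - Num.sqrt p' != 0.
  by rewrite subr_eq0; apply: contra_neq pp' => e; rewrite -a e b.
have : 0 < (Num.sqrt p - Num.sqrt p') ^+ 2 by rewrite exprn_even_gt0.
have : 0 <= (Num.sqrt (1 - p) - Num.sqrt (1 - p')) ^+ 2 by exact: sqr_ge0.
rewrite !sqrrB a b c d; lra.
Qed.

Lemma measurable_less_likely d (T : measurableType d) q q' n
    (X : nat -> T -> bool) : (forall k, measurable_fun [set: T] (X k)) ->
  measurable_fun [set: T] (fun w => less_likely q q' n (X ^~ w)).
Proof.
move=> mX; apply: measurable_fun_ler; apply: measurable_prod => i _;
  by apply: (measurableT_comp (f := _ : bool -> R)).
Qed.

Lemma affinity_ge0 q q' : 0 <= affinity q q'.
Proof. by apply: sumr_ge0 => b _; exact: sqrtr_ge0. Qed.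

End likelihood.

(** * Union bound and Borel-Cantelli lemma *)

Section borel_cantelli_geometric.
Context {R : realType} d (T : measurableType d) (P : {measure set T -> \bar R}).

Lemma lim_sup_set_geometric (F : (set T)^nat) (c : R) : 0 <= c < 1 ->
  (forall n, measurable (F n)) -> (forall n, (P (F n) <= (c ^+ n)%:E)%E) ->
  P.-negligible (lim_sup_set F).
Proof.
move=> /andP[c0 c1] mF PF; apply/negligibleP.
  apply: bigcap_measurableType => n _.
  by apply: bigcup_measurable => k _.
apply: lim_sup_set_cvg0 => //.
apply: (@le_lt_trans _ _ ((1 - c)^-1)%:E); last exact: ltry.
apply: lime_le; first exact: is_cvg_nneseries.
apply: nearW => n; apply: (le_trans (lee_sum _ (fun i _ => PF i))).
rewrite sumEFin lee_fin.
have := geometric_seriesE 1 (negbT (lt_eqF c1)) => /(congr1 (@^~ n)).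
rewrite /series/geometric/=; under eq_bigr do rewrite mul1r.
move=> ->; rewrite mul1r ler_piMl//; first by rewrite invr_ge0 subr_ge0 ltW.
by rewrite gerBl exprn_ge0.
Qed.

Lemma measure_bigsetU_le (I : Type) (r : seq I) (B : pred I) (F : I -> set T) :
  (forall i, measurable (F i)) ->
  (P (\big[setU/set0]_(i <- r | B i) F i) <= \sum_(i <- r | B i) P (F i))%E.
Proof.
move=> mF; elim: r => [|i r IH]; first by rewrite !big_nil measure0.
rewrite !big_cons; case: (B i) => //.
apply: (le_trans (measureU2 _ _ _)) => //; first exact: bigsetU_measurable.
exact: leeD2l.
Qed.

End borel_cantelli_geometric.

(** * Independent identically distributed digits *)

Section iid.
Context {R : realType} d (T : measurableType d) (P : probability T R).
Variables (X : nat -> {RV P >-> bool}) (q : bool -> R).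
Hypothesis X_indep : mutually_independent X.
Hypothesis X_law : forall n b, P [set w | X n w = b] = (q b)%:E.

Lemma cylinderE (s : seq nat) (t : nat -> bool) :
  [set w | forall i, i \in s -> X i w = t i] =
  \bigcap_(i in [set` s]) X i @^-1` [set t i].
Proof. by apply/seteqP; split => w /= H i /H. Qed.

Lemma measurable_RV_cylinder (s : seq nat) (t : nat -> bool) :
  measurable [set w | forall i, i \in s -> X i w = t i].
Proof.
rewrite cylinderE; apply: bigcap_measurableType => i _.
by rewrite -[_ @^-1` _]setTI; exact: measurable_funPT.
Qed.

Lemma cylinder_prob (s : seq nat) (t : nat -> bool) : uniq s ->
  P [set w | forall i, i \in s -> X i w = t i] = (\prod_(i <- s) q (t i))%:E.
Proof.
move=> us; rewrite cylinderE X_indep// -prodEFin.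
by apply: eq_bigr => i _; exact: X_law.
Qed.

Lemma weight_ge0 b : 0 <= q b.
Proof. by rewrite -lee_fin -(X_law 0). Qed.

Lemma measurable_RV_less_likely (q1 q2 : bool -> R) n :
  measurable [set w | less_likely q1 q2 n (X ^~ w)].
Proof. by rewrite -[X in measurable X]setTI; apply: measurable_less_likely. Qed.

(** The probability of the event is a sum over the words [f] of length [n] that
    are at most as likely under [q] as under [q']. Each term is at most the
    geometric mean of the two weights of [f]; summed over all words, these
    means give a power of the affinity by distributivity. *)
Lemma less_likely_prob (q' : bool -> R) n : (forall b, 0 <= q' b) ->
  (P [set w | less_likely q q' n (X ^~ w)] <= (affinity q q' ^+ n)%:E)%E.
Proof.
move=> q'0; have q0 := weight_ge0.
(* A word is extended to a sequence by [false]; only its first [n] values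
   matter below. *)
pose ext (f : {ffun 'I_n -> bool}) k := oapp f false (insub k).
have extE f (i : 'I_n) : ext f i = f i by rewrite /ext valK.
pose C f := [set w | forall i, i \in iota 0 n -> X i w = ext f i].
pose likely f := less_likely q q' n (ext f).
have mC f : measurable (C f) by exact: measurable_RV_cylinder.
apply: (@le_trans _ _ (P (\big[setU/set0]_(f | likely f) C f))).
  apply: le_measure; rewrite ?inE.
  - exact: measurable_RV_less_likely.
  - exact: bigsetU_measurable.
  move=> w /= lw; pose f := [ffun i : 'I_n => X i w].
  have Cf : C f w.
    by move=> i; rewrite mem_iota/= => lt; rewrite -[i]/(val (Ordinal lt)) extE ffunE.
  rewrite -bigcup_seq_cond; exists f => //=.
  rewrite mem_index_enum/=; move: lw; congr (_ <= _);
    by apply: eq_bigr => i _; rewrite extE ffunE.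
apply: (le_trans (measure_bigsetU_le _ _ _ _ _ _ _ mC)).
rewrite /affinity -[n in X in (_ <= X)%E]card_ord -prodr_const bigA_distr_bigA/=.
rewrite (eq_bigr (fun f => (\prod_(i < n) q (ext f i))%:E)); last first.
  move=> f _; rewrite cylinder_prob ?iota_uniq//; congr (_%:E).
  by rewrite -[in iota _ _](subn0 n) -/(index_iota 0 n) big_mkord.
rewrite sumEFin lee_fin [leRHS](bigID likely)/= ler_wpDr//.
  by apply: sumr_ge0 => f _; apply: prodr_ge0 => i _; exact: sqrtr_ge0.
apply: ler_sum => f lf.
under [leRHS]eq_bigr do rewrite -extE.
rewrite -sqrt_prod => [|i]; last exact: mulr_ge0.
have Q0 : 0 <= \prod_(i < n) q (ext f i) by apply: prodr_ge0.
rewrite big_split/= -[leLHS](ger0_norm Q0) -sqrtr_sqr expr2.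
by rewrite ler_wsqrtr// ler_wpM2l.
Qed.

(** Only the digit [false] needs to have weight less than 1: a run of [n] digits
    [false] has probability [q false ^+ n]. *)
Lemma infinitely_often_true : q false < 1 ->
  P.-negligible [set w | ~ forall m, exists2 k, (m <= k)%N & X k w].
Proof.
move=> q1; have q0 := weight_ge0.
pose F m n := [set w | forall i, i \in iota m n -> X i w = false].
apply: (@negligibleS _ _ _ _ (\bigcup_m lim_sup_set (F m))).
  move=> w /= /existsNP[m Hm]; exists m => // n _; exists n => //= i.
  rewrite mem_iota => /andP[mi _]; apply/negbTE/negP => Xi.
  by apply: Hm; exists i.
apply: negligible_bigcup => m; apply: (@lim_sup_set_geometric _ _ _ _ _ (q false)).
- by rewrite q0.
- by move=> n; exact: (measurable_RV_cylinder _ (fun=> false)).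
- move=> n; rewrite [X in (X <= _)%E](cylinder_prob (iota m n) (fun=> false)) ?iota_uniq//.
  by rewrite big_const_seq count_predT size_iota -Monoid.iteropE.
Qed.

End iid.

(** * Uniqueness of the law of the digit sequence *)

Section law_of_sequence.
Context {R : realType}.

(** The cylinders of the space of binary sequences: the values at finitely many
    indices are prescribed. The indices are kept distinct so that independence
    applies to them directly, and the empty set is added for stability under
    intersection. *)
Definition seq_cylinders : set (set (nat -> bool)) :=
  [set C | C = set0 \/
    exists s t, uniq s /\ C = [set a | forall i, i \in s -> a i = t i]].

Notation seqT := (g_sigma_algebraType seq_cylinders).

Lemma seq_cylinders_setI : setI_closed seq_cylinders.
Proof.
move=> A B [->|[s [t [us ->]]]]; first by left; rewrite set0I.
case=> [->|[s' [t' [us' ->]]]]; first by left; rewrite setI0.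
set A' := [set a | _]; set B' := [set a | _].
have [->|/set0P[a [/= As Bs']]] := eqVneq (A' `&` B') set0; [by left|right].
(* Two compatible cylinders meet in the cylinder that fixes both sets of
   coordinates to those of any common point. *)
exists (undup (s ++ s')), a; split; first exact: undup_uniq.
apply/seteqP; split => b /=.
  move=> [bs bs'] i; rewrite mem_undup mem_cat => /orP[is_|is'].
    by rewrite bs ?As.
  by rewrite bs' ?Bs'.
move=> H; split=> i ii; rewrite H ?mem_undup ?mem_cat ?ii ?orbT//.
  exact: As.
exact: Bs'.
Qed.

Lemma measurable_seq d (T : measurableType d) (P : probability T R)
  (X : nat -> {RV P >-> bool}) :
  measurable_fun [set: T] ((fun w => X ^~ w) : T -> seqT).
Proof.
apply: (@measurability _ _ T seqT setT (fun w => X ^~ w) seq_cylinders) => // _ [C [->|[s [t [_ ->]]]] <-].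
  by rewrite preimage_set0 setI0.
by rewrite setTI; exact: measurable_RV_cylinder.
Qed.

Lemma measurable_coord k : measurable_fun [set: seqT] (fun a : seqT => a k).
Proof.
apply: (measurable_fun_bool true); rewrite setTI.
apply: sub_sigma_algebra; right; exists [:: k], (fun=> true); split => //.
by apply/seteqP; split => a /= H; [move=> i; rewrite inE => /eqP ->|exact/H/mem_head].
Qed.

Lemma law_of_iid_unique (q : bool -> R)
  d (T : measurableType d) (P : probability T R) (X : nat -> {RV P >-> bool})
  d' (T' : measurableType d') (P' : probability T' R) (X' : nat -> {RV P' >-> bool}) :
  mutually_independent X -> (forall n b, P [set w | X n w = b] = (q b)%:E) ->
  mutually_independent X' -> (forall n b, P' [set w | X' n w = b] = (q b)%:E) ->
  forall A : set seqT, measurable A ->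
    P [set w | A (X ^~ w)] = P' [set w | A (X' ^~ w)].
Proof.
move=> X_indep X_law X'_indep X'_law A mA.
pose Y : {mfun T >-> seqT} := mfun_Sub (mem_set (measurable_seq _ _ _ X)).
pose Y' : {mfun T' >-> seqT} := mfun_Sub (mem_set (measurable_seq _ _ _ X')).
have U := @measure_unique _ R seqT seq_cylinders (fun=> setT) erefl _ _ _
  (distribution P Y) (distribution P' Y') _ _ A mA.
apply: U.
- exact: seq_cylinders_setI.
- by move=> _; right; exists [::], (fun=> false); split=> //; apply/seteqP; split.
- by rewrite bigcup_const.
- move=> _ [->|[s [t [us ->]]]]; first by rewrite !measure0.
  rewrite /distribution /pushforward.
  transitivity (\prod_(i <- s) q (t i))%:E; [|apply/esym];
    exact: cylinder_prob.
- by move=> _; exact: le_lt_trans (probability_le1 _ _) (ltry 1).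
Qed.

End law_of_sequence.

Lemma law_randomG2_unique (R : realType) (g0 : R) (hg0 : g0 \in `[2^-1, 1[)
  (q : bool -> R)
  d (T : measurableType d) (P : probability T R) (X : nat -> {RV P >-> bool})
  d' (T' : measurableType d') (P' : probability T' R) (X' : nat -> {RV P' >-> bool}) :
  mutually_independent X -> (forall n b, P [set w | X n w = b] = (q b)%:E) ->
  mutually_independent X' -> (forall n b, P' [set w | X' n w = b] = (q b)%:E) ->
  eq_distribution (P1 := P) (P2 := P') (randomG2 hg0 X) (randomG2 hg0 X').
Proof.
move=> X_indep X_law X'_indep X'_law A mA.
rewrite /distribution /pushforward.
apply: (law_of_iid_unique q _ _ _ _ _ _ _ _ X_indep X_law X'_indep X'_law
  (DeltaG2 g0 @^-1` A)).
(* Some law on the space of sequences is needed to see the coordinates as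
   random variables; that of [X] serves. *)
pose Y : {mfun T >-> g_sigma_algebraType seq_cylinders} :=
  mfun_Sub (mem_set (measurable_seq _ _ _ X)).
pose coord k : {RV (distribution P Y) >-> bool} :=
  mfun_Sub (mem_set (measurable_coord k)).
have := measurable_funPT (randomG2 hg0 coord).
by move=> /(_ measurableT A mA); rewrite setTI.
Qed.

(** * The separating set *)

Section singularity.
Context {R : realType} {g0 : R} (hg0 : g0 \in `[2^-1, 1[).
Variables q q' : bool -> R.

(** The numbers of [[0, g0]] whose first [n] digits are more likely under [q]
    than under [q'] for all large [n]. *)
Definition likelihood_set : set R :=
  [set` `[0, g0]] `&`
  ~` lim_sup_set (fun n => [set x | less_likely q q' n (G2digit (g0 := g0) ^~ x)]).

Lemma measurable_likelihood_set : measurable likelihood_set.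
Proof.
apply: measurableI; first exact: measurable_itv.
apply: measurableC; apply: bigcap_measurableType => n _.
apply: bigcup_measurable => k _; rewrite -[X in measurable X]setTI.
apply: (measurable_less_likely _ _ _ _ _ (fun j => G2digit j)) => // j; exact: measurable_G2digit.
Qed.

Lemma likelihood_set_Delta (a : nat -> bool) : (forall m, exists2 k, (m <= k)%N & a k) ->
  likelihood_set (DeltaG2 g0 a) <->
  exists m, forall n, (m <= n)%N -> ~~ less_likely q q' n a.
Proof.
move=> inf1.
have L n : less_likely q q' n (fun k => G2digit (g0 := g0) k (DeltaG2 g0 a)) =
           less_likely q q' n a.
  by congr (_ <= _); apply: eq_bigr => i _; rewrite (G2digit_Delta hg0).
split=> [[_ nL]|[m Hm]].
  apply: contrapT => H; apply: nL => m _; apply: contrapT => K; apply: H.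
  by exists m => n mn; apply/negP => l; apply: K; exists n => //=; rewrite L.
split; first by rewrite /= in_itv/=; exact: DeltaG2_itv.
move=> /(_ m I)[n /= mn]; rewrite L; exact/negP/Hm.
Qed.

Lemma measurable_randomG2_likelihood d (T : measurableType d)
    (P : probability T R) (X : nat -> {RV P >-> bool}) :
  measurable [set w | likelihood_set (randomG2 hg0 X w)].
Proof.
rewrite -[X in measurable X]setTI.
exact: (measurable_funPT (randomG2 hg0 X) _ _ measurable_likelihood_set).
Qed.

Hypothesis q_ge0 : forall b, 0 <= q b.
Hypothesis q'_ge0 : forall b, 0 <= q' b.
Hypothesis aff_lt1 : affinity q q' < 1.

Lemma likelihood_set_prob1 d (T : measurableType d) (P : probability T R)
    (X : nat -> {RV P >-> bool}) : q false < 1 -> mutually_independent X ->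
  (forall n b, P [set w | X n w = b] = (q b)%:E) ->
  P [set w | likelihood_set (randomG2 hg0 X w)] = 1%E.
Proof.
move=> qf X_indep X_law.
have mE : measurable [set w | likelihood_set (randomG2 hg0 X w)].
  exact: measurable_randomG2_likelihood.
rewrite -[X in P X]setCK probability_setC; last exact: measurableC.
suff /negligibleP -> : P.-negligible (~` [set w | likelihood_set (randomG2 hg0 X w)]).
- by rewrite sube0.
- exact: measurableC.
have io : P.-negligible [set w | ~ forall m, exists2 k, (m <= k)%N & X k w].
  exact: infinitely_often_true X_law qf.
have ls : P.-negligible
    (lim_sup_set (fun n => [set w | less_likely q q' n (X ^~ w)])).
  apply: (lim_sup_set_geometric _ _ _ _ (affinity q q')) => [|n|n].
  - by rewrite affinity_ge0.
  - exact: measurable_RV_less_likely.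
  - exact: less_likely_prob.
apply: negligibleS (negligibleU io ls) => w /= nL.
have [inf1|] := pselect (forall m, exists2 k, (m <= k)%N & X k w); [right|by left].
move=> m _; apply: contrapT => Hm; apply: nL.
apply/(likelihood_set_Delta _ inf1); exists m => n mn.
by apply/negP => l; apply: Hm; exists n.
Qed.

(** If the first [n] digits are more likely under [q] than under [q'] for all
    large [n], they are infinitely often at most as likely under [q'] as under
    [q], which has probability 0 when the digits have law [q']. *)
Lemma likelihood_set_prob0 d (T : measurableType d) (P : probability T R)
    (X : nat -> {RV P >-> bool}) : q' false < 1 -> mutually_independent X ->
  (forall n b, P [set w | X n w = b] = (q' b)%:E) ->
  P [set w | likelihood_set (randomG2 hg0 X w)] = 0%E.
Proof.
move=> qf X_indep X_law; apply/negligibleP.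
  exact: measurable_randomG2_likelihood.
have io : P.-negligible [set w | ~ forall m, exists2 k, (m <= k)%N & X k w].
  exact: infinitely_often_true X_law qf.
have ls : P.-negligible
    (lim_sup_set (fun n => [set w | less_likely q' q n (X ^~ w)])).
  apply: (lim_sup_set_geometric _ _ _ _ (affinity q' q)) => [|n|n].
  - by rewrite affinity_ge0/= affinityC.
  - exact: measurable_RV_less_likely.
  - exact: less_likely_prob.
apply: negligibleS (negligibleU io ls) => w /= L.
have [inf1|] := pselect (forall m, exists2 k, (m <= k)%N & X k w); [right|by left].
have /(likelihood_set_Delta _ inf1)[m Hm] := L.
move=> n _; exists (maxn n m) => /=; first exact: leq_maxl.
by have := Hm _ (leq_maxr n m); rewrite -ltNge => /ltW.
Qed.

End singularity.

Theorem corollary19 (R : realType) (g0 : R) (hg0 : g0 \in `[2^-1, 1[)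
  (p0 p0' : R) (hp0 : p0 \in `]0, 1[) (hp0' : p0' \in `]0, 1[)
  (d d' : measure_display) (T : measurableType d) (T' : measurableType d')
  (P : probability T R) (P' : probability T' R)
  (xi : nat -> {RV P >-> bool}) (xi' : nat -> {RV P' >-> bool})
  (xi_indep : mutually_independent xi) (xi_id : identically_distributed xi)
  (xi0 : forall n, P [set w | xi n w = false] = p0%:E)
  (xi1 : forall n, P [set w | xi n w = true] = (1 - p0)%:E)
  (xi_indep' : mutually_independent xi') (xi_id' : identically_distributed xi')
  (xi0' : forall n, P' [set w | xi' n w = false] = p0'%:E)
  (xi1' : forall n, P' [set w | xi' n w = true] = (1 - p0')%:E) :
  ~ eq_distribution (P1 := P) (P2 := P') (randomG2 hg0 xi) (randomG2 hg0 xi') ->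
  exists B : set R,
    [/\ measurable B, B `<=` [set` `[0, g0]],
        P [set w | B (randomG2 hg0 xi w)] = 1%E &
        P' [set w | B (randomG2 hg0 xi' w)] = 0%E].
Proof.
have law d1 (S : measurableType d1) (Q : probability S R)
    (X : nat -> {RV Q >-> bool}) (p : R) :
    (forall n, Q [set w | X n w = false] = p%:E) ->
    (forall n, Q [set w | X n w = true] = (1 - p)%:E) ->
    forall n b, Q [set w | X n w = b] = (bernoulli_weight p b)%:E.
  by move=> X0 X1 n [].
move=> neq; have [pp'|pp'] := eqVneq p0 p0'.
  exfalso; apply: neq; subst p0'.
  by apply: (law_randomG2_unique _ _ hg0 (bernoulli_weight p0)) => //; exact: law.
have w0 (p : R) : p \in `]0, 1[ -> forall b, 0 <= bernoulli_weight p b.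
  by rewrite in_itv/= => /andP[? ?] []; rewrite /bernoulli_weight; lra.
have aff := affinity_bernoulli_lt1 _ _ hp0 hp0' pp'.
exists (likelihood_set (g0 := g0) (bernoulli_weight p0) (bernoulli_weight p0')).
split.
- exact: measurable_likelihood_set.
- by move=> x [].
- apply: likelihood_set_prob1 => //; [exact: w0| |exact: law].
  by move: hp0; rewrite in_itv/= => /andP[].
- apply: likelihood_set_prob0 => //; [exact: w0| |exact: law].
  by move: hp0'; rewrite in_itv/= => /andP[].
Qed.
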